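(* Let $k$ be a field and let $V=k[t,t^{-1}]$. The double bracket $$\{\!\{f,g\}\!\}_1(x,y)=y\,\frac{f(x)g(y)-g(x)f(y)}{y-x},\qquad f,g\in V,$$ is a double Lie bracket of weight $1$, i.e. $(V,\{\!\{\cdot,\cdot\}\!\}_1)$ is a $1$-double Lie algebra. Moreover, the $1$-double Lie algebra $(V,\{\!\{\cdot,\cdot\}\!\}_1)$ is simple.
   Context: $k$ is a field, $V=k[t,t^{-1}]$ is the space of Laurent polynomials, and $V\otimes V$ (tensor product over $k$) is identified with $k[x^{\pm1},y^{\pm1}]$ by $t^a\otimes t^b\leftrightarrow x^ay^b$ (so $x=t\otimes 1$, $y=1\otimes t$). Since $y-x$ divides $f(x)g(y)-g(x)f(y)$ in $k[x^{\pm1},y^{\pm1}]$, the quotient is understood as an element of $k[x^{\pm1},y^{\pm1}]=V\otimes V$. For a vector space $W$ over $k$, $u\in W^{\otimes n}$ and a permutation $\sigma$ of the tensor factors, $u^\sigma$ denotes the result of applying $\sigma$ to $u$ (e.g. $(a\otimes b\otimes c)^{(12)}=b\otimes a\otimes c$). Let $\lambda\in k$. A $\lambda$-double Lie algebra (a space with a double Lie bracket of weight $\lambda$) is a vector space $W$ over $k$ with a bilinear map $\{\!\{\cdot,\cdot\}\!\}\colon W\times W\to W\otimes W$ such that for all $a,b,c\in W$ $$\{\!\{a,b\}\!\}+\{\!\{b,a\}\!\}^{(12)}=\lambda(a\otimes b-b\otimes a),$$ $$\{\!\{a,\{\!\{b,c\}\!\}\}\!\}_L-\{\!\{b,\{\!\{a,c\}\!\}\}\!\}_R-\{\!\{\{\!\{a,b\}\!\},c\}\!\}_L=-\lambda\,(b\otimes\{\!\{a,c\}\!\})^{(12)},$$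 where the actions on tensor products are determined (linearly) by $$\{\!\{a,u\otimes v\}\!\}_L=\{\!\{a,u\}\!\}\otimes v,\quad \{\!\{a,u\otimes v\}\!\}_R=u\otimes\{\!\{a,v\}\!\},\quad \{\!\{u\otimes v,a\}\!\}_L=(\{\!\{u,a\}\!\}\otimes v)^{(23)}.$$ A subspace $I\subseteq W$ is an ideal if $\{\!\{W,I\}\!\}+\{\!\{I,W\}\!\}\subseteq I\otimes W+W\otimes I$. A $\lambda$-double Lie algebra is simple if its double product is nonzero and its only ideals are $0$ and $W$. *)

(* Defs.v *)
From HB Require Import structures.
From mathcomp Require Import all_boot all_order all_algebra.
From mathcomp Require Import finmap.
From mathcomp Require Import boolp classical_sets.
From mathcomp Require Import monalg.

Set Implicit Arguments.
Unset Strict Implicit.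
Unset Printing Implicit Defensive.

Import Order.TTheory GRing.Theory Num.Theory.

Local Open Scope classical_set_scope.
Local Open Scope ring_scope.

Reserved Notation "u ⊗ v" (at level 40, left associativity).

Section Subspaces.
Variables (k : fieldType) (M : lmodType k).
Implicit Types A B : set M.

Definition subspace A : Prop :=
  A 0 /\ forall (c : k) (u v : M), A u -> A v -> A (c *: u + v).

Definition span A : set M := smallest subspace A.

Definition ssum A B : set M := [set u + v | u in A & v in B].

Lemma span_subspace A : subspace (span A).
Proof.
split=> [W [[W0 _] _] //|c u v uA vA W [sW AW]].
by apply: sW.2; [apply: uA|apply: vA].
Qed.

Lemma sub_span A : A `<=` span A. Proof. exact: sub_gen_smallest. Qed.

Lemma span_min A B : subspace B -> A `<=` B -> span A `<=` B.
Proof. exact: smallest_sub. Qed.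

End Subspaces.

(* {malg k[T]} is the vector space with basis T (<< a >> is the basis vector *)
(* of a); linext h is the linear map extending h : T -> M.                   *)
HB.lock Definition linext {k : fieldType} {T : choiceType} {M : lmodType k}
    (h : T -> M) (f : {malg k[T]}) : M :=
  \sum_(a <- msupp f) f@_a *: h a.
Canonical linext_unlockable := Unlockable linext.unlock.

Section FreeModule.
Variables (k : fieldType) (T : choiceType).

Lemma linextw (M : lmodType k) (h : T -> M) (f : {malg k[T]}) (d : {fset T}) :
  (msupp f `<=` d)%fset -> linext h f = \sum_(a <- d) f@_a *: h a.
Proof.
move=> fd; rewrite unlock (big_fset_incl _ fd) //= => a _ aNf.
by rewrite mcoeff_outdom ?scale0r.
Qed.

Fact linext_is_linear (M : lmodType k) (h : T -> M) : linear (linext h).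
Proof.
move=> c f g; set d := (msupp f `|` msupp g)%fset.
have df : (msupp f `<=` d)%fset by exact: fsubsetUl.
have dg : (msupp g `<=` d)%fset by exact: fsubsetUr.
have dfg : (msupp (c *: f + g) `<=` d)%fset.
  apply: fsubset_trans (msuppD_le _ _) _; rewrite fsubUset dg andbT.
  exact: fsubset_trans (msuppZ_le _ _) df.
rewrite (linextw _ df) (linextw _ dg) (linextw _ dfg) scaler_sumr -big_split.
by apply: eq_bigr => a _; rewrite mcoeffD mcoeffZ scalerDl scalerA.
Qed.

HB.instance Definition _ (M : lmodType k) (h : T -> M) :=
  GRing.isLinear.Build k {malg k[T]} M *:%R (linext h) (linext_is_linear h).

Lemma linextU (M : lmodType k) (h : T -> M) (a : T) :
  linext h << a >> = h a.
Proof.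
rewrite (linextw _ msuppU_le) big_seq_fset1.
by rewrite mcoeffUU scale1r.
Qed.

Lemma malgUZ (c : k) (a : T) : << c *g a >> = c *: << a >> :> {malg k[T]}.
Proof. by apply/malgP=> b; rewrite mcoeffZ !mcoeffU mulrnAr mulr1. Qed.

Lemma linext_id (f : {malg k[T]}) : linext (fun a => << a >>) f = f.
Proof. by rewrite [RHS]monalgE unlock; apply: eq_bigr => a _; rewrite -malgUZ. Qed.

Lemma malg_subspace (A : set {malg k[T]}) :
  subspace A -> (forall a, A << a >>) -> forall f, A f.
Proof.
move=> [A0 AD] AU f; rewrite [f]monalgE.
elim/big_ind: _ => [//|u v Au Av|a _]; first by rewrite -[u]scale1r; apply: AD.
by rewrite malgUZ -[_ *: _]addr0; apply: AD.
Qed.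

Lemma eq_malg_lin (M : lmodType k) (F G : {malg k[T]} -> M) :
  linear F -> linear G -> (forall a, F << a >> = G << a >>) -> F =1 G.
Proof.
move=> linF linG FG f.
pose F' := GRing.isLinear.Build k {malg k[T]} M *:%R F linF.
pose G' := GRing.isLinear.Build k {malg k[T]} M *:%R G linG.
pose FL : {linear {malg k[T]} -> M} := HB.pack F F'.
pose GL : {linear {malg k[T]} -> M} := HB.pack G G'.
change (FL f = GL f).
rewrite [f]monalgE !linear_sum; apply: eq_bigr => a _.
by rewrite malgUZ !linearZ; congr (_ *: _); apply: FG.
Qed.

End FreeModule.

Section TensorConstruction.
Variables (k : fieldType) (U V : lmodType k).

Inductive tensor_gen : set {malg k[(U * V)%type]} :=
| tensor_genl (c : k) (u1 u2 : U) (v : V) :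
    tensor_gen (<< (c *: u1 + u2, v) >> - (c *: << (u1, v) >> + << (u2, v) >>))
| tensor_genr (c : k) (u : U) (v1 v2 : V) :
    tensor_gen (<< (u, c *: v1 + v2) >> - (c *: << (u, v1) >> + << (u, v2) >>)).

Definition tensor_rel : {pred {malg k[(U * V)%type]}} :=
  fun x => `[< span tensor_gen x >].

Fact tensor_rel_zmod_closed : zmod_closed tensor_rel.
Proof.
have [s0 sD] := span_subspace tensor_gen.
split=> [|x y /asboolP xR /asboolP yR]; apply/asboolP => //.
by rewrite addrC -scaleN1r; apply: sD.
Qed.

HB.instance Definition _ := GRing.isZmodClosed.Build _ tensor_rel
  tensor_rel_zmod_closed.

Lemma tensor_relZ c x : x \in tensor_rel -> c *: x \in tensor_rel.
Proof.
have [s0 sD] := span_subspace tensor_gen.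
by move=> /asboolP xR; apply/asboolP; rewrite -[_ *: _]addr0; apply: sD.
Qed.

Definition tensor : Type := (Quotient.quot tensor_rel).

HB.instance Definition _ := GRing.Zmodule.copy tensor (Quotient.quot tensor_rel).

Definition tpi (x : {malg k[(U * V)%type]}) : tensor := \pi_((Quotient.quot tensor_rel))%qT x.
Definition trepr (z : tensor) : {malg k[(U * V)%type]} := repr (z : (Quotient.quot tensor_rel)).

Lemma treprK : cancel trepr tpi. Proof. by move=> z; apply: reprK. Qed.

Lemma tpi_eq x y : tpi x = tpi y <-> x - y \in tensor_rel.
Proof. by rewrite Quotient.idealrBE; split=> [xy|/eqP//]; apply/eqP. Qed.

Fact tpi_is_zmod_morphism : zmod_morphism tpi.
Proof. by move=> x y; rewrite /tpi raddfB. Qed.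

HB.instance Definition _ :=
  GRing.isZmodMorphism.Build _ _ tpi tpi_is_zmod_morphism.

Definition tscale (c : k) (z : tensor) : tensor := tpi (c *: trepr z).

Lemma tscale_pi c x : tscale c (tpi x) = tpi (c *: x).
Proof.
apply/tpi_eq; rewrite -scalerBr; apply: tensor_relZ.
by apply/tpi_eq; rewrite treprK.
Qed.

Fact tscaleA a b z : tscale a (tscale b z) = tscale (a * b) z.
Proof. by rewrite -[z]treprK !tscale_pi scalerA. Qed.

Fact tscale1 : left_id 1 tscale.
Proof. by move=> z; rewrite -[z]treprK tscale_pi scale1r. Qed.

Fact tscaleDr : right_distributive tscale +%R.
Proof.
move=> c y z; rewrite -[y]treprK -[z]treprK -raddfD !tscale_pi.
by rewrite scalerDr raddfD.
Qed.

Fact tscaleDl z : {morph tscale^~ z : a b / a + b}.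
Proof.
by move=> a b; rewrite -[z]treprK !tscale_pi scalerDl raddfD.
Qed.

HB.instance Definition _ := GRing.Zmodule_isLmodule.Build k tensor
  tscaleA tscale1 tscaleDr tscaleDl.

Fact tpi_is_scalable : scalable tpi.
Proof. by move=> c x; rewrite -tscale_pi. Qed.

HB.instance Definition _ := GRing.isScalable.Build k _ _ _ tpi tpi_is_scalable.

End TensorConstruction.

Notation "U ⊗ V" := (tensor U V) : type_scope.

HB.lock Definition tens {k : fieldType} {U V : lmodType k} (u : U) (v : V) :
    (U ⊗ V)%type := tpi << (u, v) >>.

Notation "u ⊗ v" := (tens u v) : ring_scope.

(* The linear map induced by a bilinear map f. If f is not bilinear, the     *)
(* value depends on the choice of representatives.                           *)
HB.lock Definition tlift {k : fieldType} {U V M : lmodType k} (f : U -> V -> M)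
    (z : (U ⊗ V)%type) : M :=
  linext (fun p => f p.1 p.2) (trepr z).

Section UniversalProperty.
Variables (k : fieldType) (U V M : lmodType k).

Fact tens_bilinear : bilinear_for *:%R *:%R (@tens k U V).
Proof.
split=> [v c u1 u2|u c v1 v2]; rewrite tens.unlock -linearP; apply/tpi_eq;
  apply/asboolP; apply: sub_span; [exact: tensor_genl|exact: tensor_genr].
Qed.

HB.instance Definition _ :=
  bilinear_isBilinear.Build k U V (U ⊗ V)%type *:%R *:%R (@tens k U V)
    tens_bilinear.

Lemma tlift_pi (f : U -> V -> M) x : bilinear_for *:%R *:%R f ->
  tlift f (tpi x) = linext (fun p => f p.1 p.2) x.
Proof.
move=> [fl fr]; rewrite tlift.unlock; set h := fun p => _.
have [L LE] : exists L : {linear {malg k[(U * V)%type]} -> M}, linext h =1 L.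
  by exists (linext h).
have LU p : L << p >> = h p by rewrite -LE linextU.
rewrite !LE.
suff kerL z : z \in @tensor_rel k U V -> L z = 0.
  apply/eqP; rewrite -subr_eq0 -linearB; apply/eqP/kerL/tpi_eq.
  by rewrite treprK.
move=> /asboolP; apply: (@span_min _ _ _ [set z | L z = 0]) => [|_ []].
- split=> [|c x1 x2 /= Lx1 Lx2]; first exact: linear0.
  by rewrite linearP Lx1 Lx2 scaler0 addr0.
- by move=> c u1 u2 v /=; rewrite linearB linearP !LU /h /= fl subrr.
- by move=> c u v1 v2 /=; rewrite linearB linearP !LU /h /= fr subrr.
Qed.

Lemma tliftE (f : U -> V -> M) u v :
  bilinear_for *:%R *:%R f -> tlift f (u ⊗ v) = f u v.
Proof. by move=> bf; rewrite tens.unlock tlift_pi // linextU. Qed.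

Lemma tlift_linear (f : U -> V -> M) :
  bilinear_for *:%R *:%R f -> linear (tlift f).
Proof.
move=> bf c y z; rewrite -[y]treprK -[z]treprK -linearP !tlift_pi //.
by rewrite linearP.
Qed.

Lemma eq_tensor_lin (F G : (U ⊗ V)%type -> M) : linear F -> linear G ->
  (forall u v, F (u ⊗ v) = G (u ⊗ v)) -> F =1 G.
Proof.
move=> linF linG FG z; rewrite -[z]treprK.
apply: (@eq_malg_lin _ _ _ (F \o @tpi k U V) (G \o @tpi k U V)) => [c x y|c x y|[u v]] /=.
- by rewrite linearP linF.
- by rewrite linearP linG.
- by have := FG u v; rewrite tens.unlock.
Qed.

End UniversalProperty.

Section Rearrangements.
Variable k : fieldType.
Implicit Types U V W M : lmodType k.

Lemma tensDl U V c (u1 u2 : U) (v : V) :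
  (c *: u1 + u2) ⊗ v = c *: (u1 ⊗ v) + u2 ⊗ v.
Proof. exact: (@tens_bilinear k U V).1. Qed.

Lemma tensDr U V c (u : U) (v1 v2 : V) :
  u ⊗ (c *: v1 + v2) = c *: (u ⊗ v1) + u ⊗ v2.
Proof. exact: (@tens_bilinear k U V).2. Qed.

Lemma bilinear_tlift U V W M (f : U -> V -> W -> M) :
  (forall u, bilinear_for *:%R *:%R (f u)) -> (forall v w, linear (f ^~ v ^~ w)) ->
  bilinear_for *:%R *:%R (fun u => tlift (f u)).
Proof.
move=> bf lf; split=> [z c u1 u2|u]; last exact: tlift_linear.
apply: (@eq_tensor_lin _ _ _ _ (tlift (f (c *: u1 + u2)))
   (fun z => c *: tlift (f u1) z + tlift (f u2) z)) => {z} [|d x y|v w].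
- exact: tlift_linear.
- rewrite !(tlift_linear (bf _)) !scalerDr !scalerA (mulrC c) !addrA.
  by congr (_ + _); rewrite addrAC.
- by rewrite !tliftE //; exact: lf.
Qed.

Definition tflip U V : (U ⊗ V)%type -> (V ⊗ U)%type :=
  tlift (fun u v => v ⊗ u).

Fact tflip_bilinear U V :
  bilinear_for *:%R *:%R (fun (u : U) (v : V) => v ⊗ u).
Proof. by split=> ? ? ? ?; rewrite (tensDl, tensDr). Qed.

Lemma tflip_linear U V : linear (@tflip U V).
Proof. exact/tlift_linear/tflip_bilinear. Qed.

Lemma tflipE U V (u : U) (v : V) : tflip (u ⊗ v) = v ⊗ u.
Proof. exact/tliftE/tflip_bilinear. Qed.

Definition tassoc U V W : (U ⊗ (V ⊗ W))%type -> (U ⊗ V ⊗ W)%type :=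
  tlift (fun u => tlift (fun v w => u ⊗ v ⊗ w)).

Fact tassoc_bilinear U V W (u : U) :
  bilinear_for *:%R *:%R (fun (v : V) (w : W) => u ⊗ v ⊗ w).
Proof. by split=> ? ? ? ?; rewrite ?tensDr ?tensDl. Qed.

Fact tassoc_bilinear2 U V W :
  bilinear_for *:%R *:%R
    (fun u : U => tlift (fun (v : V) (w : W) => u ⊗ v ⊗ w)).
Proof.
apply: bilinear_tlift => [u|v w c u1 u2]; first exact: tassoc_bilinear.
by rewrite !tensDl.
Qed.

Lemma tassoc_linear U V W : linear (@tassoc U V W).
Proof. exact/tlift_linear/tassoc_bilinear2. Qed.

Lemma tassocE U V W (u : U) (v : V) (w : W) :
  tassoc (u ⊗ (v ⊗ w)) = u ⊗ v ⊗ w.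
Proof.
rewrite /tassoc tliftE; last exact: tassoc_bilinear2.
by rewrite tliftE; last exact: tassoc_bilinear.
Qed.

Definition perm12 W : (W ⊗ W ⊗ W)%type -> (W ⊗ W ⊗ W)%type :=
  tlift (fun z w => tflip z ⊗ w).

Fact perm12_bilinear W :
  bilinear_for *:%R *:%R (fun (z : (W ⊗ W)%type) (w : W) => tflip z ⊗ w).
Proof. by split=> ? ? ? ?; rewrite ?tflip_linear ?tensDr ?tensDl. Qed.

Lemma perm12_linear W : linear (@perm12 W).
Proof. exact/tlift_linear/perm12_bilinear. Qed.

Lemma perm12E W (u v w : W) : perm12 (u ⊗ v ⊗ w) = v ⊗ u ⊗ w.
Proof. by rewrite /perm12 tliftE ?tflipE //; apply: perm12_bilinear. Qed.

Definition perm23 W : (W ⊗ W ⊗ W)%type -> (W ⊗ W ⊗ W)%type :=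
  tlift (fun z w => tlift (fun u v => u ⊗ w ⊗ v) z).

Fact perm23_bilinear W (w : W) :
  bilinear_for *:%R *:%R (fun u v : W => u ⊗ w ⊗ v).
Proof. by split=> ? ? ? ?; rewrite ?tensDr ?tensDl. Qed.

Fact perm23_bilinear2 W :
  bilinear_for *:%R *:%R
    (fun (z : (W ⊗ W)%type) (w : W) => tlift (fun u v => u ⊗ w ⊗ v) z).
Proof.
have [b1 b2] : bilinear_for *:%R *:%R (fun w : W => tlift (fun u v : W => u ⊗ w ⊗ v)).
  apply: bilinear_tlift => [w|u v c w1 w2]; first exact: perm23_bilinear.
  by rewrite tensDr tensDl.
by split=> ?; [exact: b2|exact: b1].
Qed.

Lemma perm23_linear W : linear (@perm23 W).
Proof. exact/tlift_linear/perm23_bilinear2. Qed.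

Lemma perm23E W (u v w : W) : perm23 (u ⊗ v ⊗ w) = u ⊗ w ⊗ v.
Proof.
rewrite /perm23 tliftE; last exact: perm23_bilinear2.
by rewrite tliftE; last exact: perm23_bilinear.
Qed.

End Rearrangements.

Section DoubleLie.
Variables (k : fieldType) (W : lmodType k).
Variable br : W -> W -> (W ⊗ W)%type.

Section Actions.

(* {{a, u ⊗ v}}_L, {{a, u ⊗ v}}_R and {{u ⊗ v, a}}_L, extended linearly:     *)
(* see actLE, actRE and ractLE.                                              *)
Definition actL (a : W) : (W ⊗ W)%type -> (W ⊗ W ⊗ W)%type :=
  tlift (fun u v => br a u ⊗ v).

Definition actR (a : W) : (W ⊗ W)%type -> (W ⊗ W ⊗ W)%type :=
  tlift (fun u v => tassoc (u ⊗ br a v)).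

Definition ractL (z : (W ⊗ W)%type) (a : W) : (W ⊗ W ⊗ W)%type :=
  tlift (fun u v => perm23 (br u a ⊗ v)) z.

Hypothesis br_bilinear : bilinear_for *:%R *:%R br.

Fact actL_bilinear a : bilinear_for *:%R *:%R (fun u v : W => br a u ⊗ v).
Proof. by split=> ? ? ? ?; rewrite ?br_bilinear.2 ?tensDr ?tensDl. Qed.

Lemma actLE a u v : actL a (u ⊗ v) = br a u ⊗ v.
Proof. exact/tliftE/actL_bilinear. Qed.

Fact actR_bilinear a :
  bilinear_for *:%R *:%R (fun u v : W => tassoc (u ⊗ br a v)).
Proof.
split=> [v|u] c x y; last rewrite br_bilinear.2 tensDr; first rewrite tensDl.
  exact: tassoc_linear.
exact: tassoc_linear.
Qed.

Lemma actRE a u v : actR a (u ⊗ v) = tassoc (u ⊗ br a v).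
Proof. exact/tliftE/actR_bilinear. Qed.

Fact ractL_bilinear a :
  bilinear_for *:%R *:%R (fun u v : W => perm23 (br u a ⊗ v)).
Proof.
split=> [v|u] c x y; last rewrite tensDr; first rewrite br_bilinear.1 tensDl.
  exact: perm23_linear.
exact: perm23_linear.
Qed.

Lemma ractLE u v a : ractL (u ⊗ v) a = perm23 (br u a ⊗ v).
Proof. exact/tliftE/ractL_bilinear. Qed.

End Actions.

Record is_double_Lie (lambda : k) : Prop := IsDoubleLie {
  dL_bilinear : bilinear_for *:%R *:%R br;
  dL_skew : forall a b : W,
    br a b + tflip (br b a) = lambda *: (a ⊗ b - b ⊗ a);
  dL_jacobi : forall a b c : W,
    actL a (br b c) - actR b (br a c) - ractL (br a b) c
    = - (lambda *: perm12 (tassoc (b ⊗ br a c)))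
}.

(* A ⊗ B as a subspace of W ⊗ W *)
Definition subtens (A B : set W) : set (W ⊗ W)%type :=
  span [set a ⊗ b | a in A & b in B].

(* {{A, B}} *)
Definition subbr (A B : set W) : set (W ⊗ W)%type :=
  span [set br a b | a in A & b in B].

Definition dL_ideal (I : set W) : Prop :=
  subspace I /\
  ssum (subbr setT I) (subbr I setT) `<=` ssum (subtens I setT) (subtens setT I).

Definition dL_simple : Prop :=
  (exists a b : W, br a b != 0) /\
  forall I : set W, dL_ideal I -> I = [set 0] \/ I = setT.

End DoubleLie.

(* The group algebra of the additive group G; gmon g is the basis element    *)
(* of g, so that gmon a * gmon b = gmon (a + b).                             *)
Definition grpalg (k : fieldType) (G : zmodType) : Type := {malg k[G]}.

HB.instance Definition _ (k : fieldType) (G : zmodType) :=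
  GRing.Lmodule.copy (grpalg k G) {malg k[G]}.

HB.lock Definition gmon {k : fieldType} {G : zmodType} (g : G) : grpalg k G :=
  << g >>.
Canonical gmon_unlockable := Unlockable gmon.unlock.

HB.lock Definition gmul {k : fieldType} {G : zmodType} (f1 f2 : grpalg k G) :
    grpalg k G :=
  linext (fun a => linext (fun b => gmon (a + b)) f2) f1.
Canonical gmul_unlockable := Unlockable gmul.unlock.

Section GroupAlgebra.
Variables (k : fieldType) (G : zmodType).
Local Notation grpalg := (grpalg k G).
Implicit Types f : grpalg.

Lemma gmonE (g : G) : gmon g = << g >> :> grpalg. Proof. by rewrite unlock. Qed.

Lemma linext_gmon (M : lmodType k) (h : G -> M) (g : G) :
  linext h (gmon g : grpalg) = h g.
Proof. by rewrite gmonE linextU. Qed.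

Lemma grpalg_subspace (A : set grpalg) :
  subspace A -> (forall g, A (gmon g)) -> forall f, A f.
Proof.
by move=> sA AU; apply: malg_subspace => // g; rewrite -gmonE; apply: AU.
Qed.

Lemma eq_grpalg_lin (M : lmodType k) (F H : grpalg -> M) :
  linear F -> linear H -> (forall g, F (gmon g) = H (gmon g)) -> F =1 H.
Proof.
by move=> lF lH FH; apply: eq_malg_lin => // g; rewrite -gmonE; apply: FH.
Qed.

Fact gmul_linl f2 : linear (gmul^~ f2).
Proof. by move=> c x y; rewrite gmul.unlock linearP. Qed.

Lemma gmul_mon (a b : G) : gmul (gmon a) (gmon b) = gmon (a + b) :> grpalg.
Proof. by rewrite gmul.unlock !linext_gmon. Qed.

Fact gmulC : commutative (@gmul k G).
Proof.
have sw f1 f2 : gmul f1 f2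
    = \sum_(a <- msupp f1) \sum_(b <- msupp f2) (f1@_a * f2@_b) *: gmon (a + b).
  rewrite gmul.unlock linext.unlock; apply: eq_bigr => a _.
  rewrite scaler_sumr.
  by apply: eq_bigr => b _; rewrite scalerA.
move=> f1 f2; rewrite !sw exchange_big; apply: eq_bigr => b _.
by apply: eq_bigr => a _; rewrite addrC mulrC.
Qed.

Fact gmul_linr f1 : linear (gmul f1).
Proof. by move=> c x y; rewrite !(gmulC f1); apply: gmul_linl. Qed.

Fact gmulA : associative (@gmul k G).
Proof.
move=> f1 f2 f3; move: f1.
apply: (@eq_grpalg_lin _ (gmul^~ (gmul f2 f3))
                        (fun f => gmul (gmul f f2) f3)) => [||a].
- exact: gmul_linl.
- by move=> c x y; rewrite !gmul_linl.
move: f2; apply: (@eq_grpalg_lin _ (fun f => gmul (gmon a) (gmul f f3))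
                        (fun f => gmul (gmul (gmon a) f) f3)) => [||b].
- by move=> c x y; rewrite gmul_linl gmul_linr.
- by move=> c x y; rewrite gmul_linr gmul_linl.
move: f3; apply: (@eq_grpalg_lin _ (fun f => gmul (gmon a) (gmul (gmon b) f))
                        (fun f => gmul (gmul (gmon a) (gmon b)) f)) => [||d].
- by move=> c x y; rewrite !gmul_linr.
- by move=> c x y; rewrite !gmul_linr.
by rewrite !gmul_mon addrA.
Qed.

Fact gmul1 : left_id (gmon 0) (@gmul k G).
Proof.
apply: eq_grpalg_lin => [||g]; first exact: gmul_linr; first by [].
by rewrite gmul_mon add0r.
Qed.

Fact gmulDl : left_distributive (@gmul k G) +%R.
Proof. by move=> x y f; have := gmul_linl f 1 x y; rewrite !scale1r. Qed.

Fact gmon0_neq0 : gmon 0 != 0 :> grpalg.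
Proof.
by apply/eqP; rewrite gmonE => /malgP/(_ 0)/eqP; rewrite mcoeffUU mcoeff0 oner_eq0.
Qed.

HB.instance Definition _ := GRing.Zmodule_isComNzRing.Build grpalg
  gmulA gmulC gmul1 gmulDl gmon0_neq0.

Fact gscaleAl (c : k) (x y : grpalg) : c *: (x * y) = (c *: x) * y.
Proof. by rewrite /GRing.mul /= gmul.unlock linearZ. Qed.

HB.instance Definition _ := GRing.Lmodule_isLalgebra.Build k grpalg gscaleAl.
HB.instance Definition _ := GRing.Lalgebra_isComAlgebra.Build k grpalg.

Lemma gmonM (a b : G) : gmon a * gmon b = gmon (a + b) :> grpalg.
Proof. exact: gmul_mon. Qed.

Lemma gmon0 : gmon 0 = 1 :> grpalg. Proof. by []. Qed.

Lemma gmonX (a : G) n : gmon a ^+ n = gmon (a *+ n) :> grpalg.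
Proof. by elim: n => // n IHn; rewrite exprS IHn gmonM mulrS. Qed.

Lemma mcoeff_gmon (a b : G) : (gmon a : grpalg)@_b = (a == b)%:R.
Proof. by rewrite gmonE mcoeffU. Qed.

Lemma mcoeff_mulgmon f (a b : G) : (f * gmon a)@_b = f@_(b - a).
Proof.
move: f; apply: grpalg_subspace => [|d].
  split=> [|c u v /= uE vE] /=; first by rewrite mul0r !mcoeff0.
  by rewrite mulrDl -scalerAl !mcoeffD !mcoeffZ uE vE.
rewrite /= gmonM !mcoeff_gmon; congr (nat_of_bool _)%:R.
by apply/eqP/eqP => [<-|->]; rewrite ?addrK ?subrK.
Qed.

End GroupAlgebra.

(* k[t, 1/t] and k[x, 1/x, y, 1/y] as the group algebras of Z and Z^2.       *)
Notation laurent k := (grpalg k int).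
Notation laurent2 k := (grpalg k (int * int)%type).

Section Laurent.
Variable k : fieldType.

(* t^a and x^a y^b *)
Definition tmon (a : int) : laurent k := gmon a.
Definition xymon (a b : int) : laurent2 k := gmon (a, b).

Lemma tmonE a : tmon a = gmon a. Proof. by []. Qed.
Lemma xymonE a b : xymon a b = gmon (a, b). Proof. by []. Qed.

Lemma xymonM a b c d : xymon a b * xymon c d = xymon (a + c) (b + d).
Proof. exact: gmonM. Qed.

Lemma xymonX a b n : xymon a b ^+ n = xymon (a *+ n) (b *+ n).
Proof. by elim: n => // n IHn; rewrite exprS IHn xymonM -!mulrS. Qed.

Lemma mcoeff_mulxymon (p : laurent2 k) (a b c d : int) :
  (p * xymon a b)@_((c, d) : int * int) = p@_((c - a, d - b) : int * int).
Proof. exact: mcoeff_mulgmon. Qed.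

Definition lx : laurent2 k := xymon 1 0.
Definition ly : laurent2 k := xymon 0 1.

(* f(x) and f(y) *)
Definition atx (f : laurent k) : laurent2 k := linext (fun a => xymon a 0) f.
Definition aty (f : laurent k) : laurent2 k := linext (fun a => xymon 0 a) f.

Fact atx_is_linear : linear atx.
Proof. by move=> c f g; rewrite /atx linearP. Qed.

Fact aty_is_linear : linear aty.
Proof. by move=> c f g; rewrite /aty linearP. Qed.

HB.instance Definition _ :=
  GRing.isLinear.Build k (laurent k) (laurent2 k) *:%R atx atx_is_linear.
HB.instance Definition _ :=
  GRing.isLinear.Build k (laurent k) (laurent2 k) *:%R aty aty_is_linear.

Lemma atxU a : atx (tmon a) = xymon a 0. Proof. exact: linext_gmon. Qed.
Lemma atyU a : aty (tmon a) = xymon 0 a. Proof. exact: linext_gmon. Qed.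

(* The identification of k[x, 1/x, y, 1/y] with V ⊗ V. *)
Definition toTensor (p : laurent2 k) : (laurent k ⊗ laurent k)%type :=
  linext (fun ab : int * int => tmon ab.1 ⊗ tmon ab.2) p.

Fact toTensor_is_linear : linear toTensor.
Proof. by move=> c f g; rewrite /toTensor linearP. Qed.

HB.instance Definition _ :=
  GRing.isLinear.Build k (laurent2 k) (laurent k ⊗ laurent k)%type *:%R toTensor
    toTensor_is_linear.

Lemma toTensorU a b : toTensor (xymon a b) = tmon a ⊗ tmon b.
Proof. exact: linext_gmon. Qed.

Lemma atxyU a b : atx (tmon a) * aty (tmon b) = xymon a b.
Proof. by rewrite atxU atyU xymonM addr0 add0r. Qed.

(* f(x) g(y) - g(x) f(y) *)
Definition numer (f g : laurent k) : laurent2 k := atx f * aty g - atx g * aty f.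

Lemma numer_bilinear : bilinear_for *:%R *:%R numer.
Proof.
have aux (A : comAlgType k) (c : k) (p q r s u v : A) :
    ((c *: p + q) * r - u * (c *: v + s)
       = c *: (p * r - u * v) + (q * r - u * s)) *
    (u * (c *: v + s) - (c *: p + q) * r
       = c *: (u * v - p * r) + (u * s - q * r)).
  have E : (c *: p + q) * r - u * (c *: v + s)
      = c *: (p * r - u * v) + (q * r - u * s).
    by rewrite mulrDl mulrDr -scalerAl -scalerAr opprD addrACA -scalerBr.
  by split=> //; rewrite -opprB E opprD -scalerN !opprB.
by split=> u c v w; rewrite /numer atx_is_linear aty_is_linear aux.
Qed.

(* p / d, when d divides p and is not a zero divisor. Both hold in br1: see  *)
(* lyx_dvd and lyx_reg.                                                      *)
Definition lquot (p d : laurent2 k) : laurent2 k := xget 0 [set q | q * d = p].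

Fact lyx_dvd (f g : laurent k) :
  exists q : laurent2 k, q * (ly - lx) = numer f g.
Proof.
pose D (p : laurent2 k) := exists q : laurent2 k, q * (ly - lx) = p.
have D0 : D 0 by exists 0; rewrite mul0r.
have DD (c : k) p1 p2 : D p1 -> D p2 -> D (c *: p1 + p2).
  by move=> [q1 <-] [q2 <-]; exists (c *: q1 + q2); rewrite mulrDl -scalerAl.
have DN p : D p -> D (- p) by move=> [q <-]; exists (- q); rewrite mulNr.
have DU (a : int) (n : nat) : D (xymon a (a + n%:Z) - xymon (a + n%:Z) a).
  exists (xymon a a * \sum_(i < n) ly ^+ (n.-1 - i) * lx ^+ i).
  rewrite -mulrA [X in _ * X]mulrC -subrXX mulrBr !xymonX !xymonM.
  by rewrite !mul0rn !addr0 natz.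
have DU2 (a b : int) : D (xymon a b - xymon b a).
  wlog ab : a b / a <= b => [dab|].
    have [le_ab|/ltW le_ba] := leP a b; first exact: (dab _ _ le_ab).
    rewrite -(opprB (xymon b a)); exact: (DN _ (dab _ _ le_ba)).
  have [n ->] : exists n : nat, b = a + n%:Z.
    by exists `|b - a|%N; rewrite gez0_abs ?subr_ge0 // addrCA subrr addr0.
  exact: DU.
have [nl nr] := numer_bilinear.
rewrite -/(D _); move: f; apply: grpalg_subspace => [|a].
  split=> [|c f1 f2 df1 df2]; rewrite /mkset; last by rewrite nl; apply: DD.
  by rewrite /numer !raddf0 mul0r mulr0 subrr.
move: g; apply: grpalg_subspace => [|b].
  split=> [|c f1 f2 df1 df2]; rewrite /mkset; last by rewrite nr; apply: DD.
  by rewrite /numer !raddf0 mul0r mulr0 subrr.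
by rewrite -!tmonE /numer !atxyU.
Qed.

Fact lyx_reg (p q : laurent2 k) : p * (ly - lx) = q * (ly - lx) -> p = q.
Proof.
move=> /eqP; rewrite -subr_eq0 -mulrBl => /eqP pq0; apply/eqP.
rewrite -subr_eq0; apply/eqP; move: (p - q) pq0 => {p q} p p0.
pose c (i j : int) := p@_((i, j) : int * int).
have cS i j : c i j = c (i - 1) (j + 1).
  have := congr1 (fun r : laurent2 k => r@_((i, j + 1) : int * int)) p0.
  rewrite mulrBr mcoeffB mcoeff0 !mcoeff_mulxymon !subr0 addrK => /eqP.
  by rewrite subr_eq0 => /eqP.
have cSn n i j : c i j = c (i - n%:Z) (j + n%:Z).
  elim: n => [|n IHn]; first by rewrite subr0 addr0.
  by rewrite IHn cS -!addrA -opprD -!PoszD addn1.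
apply/malgP=> -[i j]; rewrite mcoeff0; apply/eqP/negP => /negP nz_ij.
pose s := [seq ((i - n%:Z, j + n%:Z) : int * int) | n <- iota 0 (size (msupp p)).+1].
have us : uniq s.
  rewrite map_inj_uniq ?iota_uniq // => m n [/addrI/oppr_inj]; by case.
have /(uniq_leq_size us) : {subset s <= msupp p}.
  by move=> _ /mapP[n _ ->]; rewrite -mcoeff_neq0 -/(c _ _) -cSn.
by rewrite size_map size_iota ltnn.
Qed.

Lemma lquotP (f g : laurent k) (q : laurent2 k) :
  q * (ly - lx) = numer f g -> lquot (numer f g) (ly - lx) = q.
Proof.
by move=> qE; apply: xget_unique => // q'; rewrite /= -qE => /lyx_reg.
Qed.

Lemma toTensorM (f g : laurent k) : toTensor (atx f * aty g) = f ⊗ g.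
Proof.
move: f; apply: (@eq_grpalg_lin _ _ _ (fun f => toTensor (atx f * aty g))
                                   (fun f => f ⊗ g)) => [c u v|c u v|a] /=.
- by rewrite linearP mulrDl -scalerAl linearP.
- exact: tensDl.
rewrite -tmonE; move: g.
apply: (@eq_grpalg_lin _ _ _ (fun f => toTensor (atx (tmon a) * aty f))
                           (fun f => tmon a ⊗ f)) => [c u v|c u v|b] /=.
- by rewrite linearP mulrDr -scalerAr linearP.
- exact: tensDr.
by rewrite -tmonE atxyU toTensorU.
Qed.

Lemma toTensor_bij : bijective toTensor.
Proof.
have bM : bilinear_for *:%R *:%R (fun f g : laurent k => atx f * aty g).
  split=> u c x y; rewrite linearP; first by rewrite mulrDl -scalerAl.
  by rewrite mulrDr -scalerAr.
exists (tlift (fun f g : laurent k => atx f * aty g)) => [p|z].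
  move: p; apply: (@eq_grpalg_lin _ _ _ _ id) => [c u v|//|[a b]].
    by rewrite linearP (tlift_linear bM).
  by rewrite -xymonE toTensorU tliftE // atxyU.
apply: (@eq_tensor_lin _ _ _ _ (fun z => toTensor (tlift _ z)) id) => //.
  by move=> c u v; rewrite (tlift_linear bM) linearP.
by move=> f g; rewrite tliftE // toTensorM.
Qed.

Definition br1 (f g : laurent k) : (laurent k ⊗ laurent k)%type :=
  toTensor (ly * lquot (numer f g) (ly - lx)).

End Laurent.

(* Main.v *)
(* Jacobi identity.  Each term is the image of a Laurent polynomial P in       *)
(* three variables x1, x2, x3, for which P * (xj - xi) is explicit; after     *)
(* multiplication by (x2 - x1) (x3 - x2) (x3 - x1), a non-zero-divisor, the   *)
(* identity becomes a polynomial one.                                         *)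
(*                                                                            *)
(* Simplicity.  If phi is a linear functional vanishing on an ideal I, then   *)
(* phi ⊗ id maps I ⊗ V + V ⊗ I into I, hence maps {{f, g}} into I for g in I. *)
(* For g in I supported in degrees a..b, either t^a is in I or some phi has   *)
(* phi(t^a) = 1, and then (phi ⊗ id){{t^a, g}} is a nonzero element of I      *)
(* supported in degrees a+1..b; so a nonzero I contains a monomial t^m. From  *)
(* {{t^m, t^(m+2)}} = t^m ⊗ t^(m+2) + t^(m+1) ⊗ t^(m+1), if one of t^m,       *)
(* t^(m+2) is in I, then so is t^(m+1); hence every monomial is in I.         *)
Require Import Defs.
From HB Require Import structures.
From mathcomp Require Import all_boot all_order all_algebra.
From mathcomp Require Import finmap.
From mathcomp Require Import boolp classical_sets.
From mathcomp Require Import monalg.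
From mathcomp Require Import ring zify.

Set Implicit Arguments.
Unset Strict Implicit.
Unset Printing Implicit Defensive.

Import Order.TTheory GRing.Theory Num.Theory.

Local Open Scope classical_set_scope.
Local Open Scope ring_scope.

(** Write q(f,g) for the quotient ([divdiff]), so that {{f,g}} = y q(f,g). It changes sign when f
    and g are exchanged and is invariant when x and y are ([divdiffC], [lswap_divdiff]). Hence
    {{a,b}} + {{b,a}}^(12) = (y - x) q(a,b) = a(x) b(y) - b(x) a(y), the skew-symmetry of weight 1
    ([br1_skew]). For [br1_jacobi], the lemmas [actL_preimage], [actR_preimage] and [ractL_preimage]
    express the three double actions by Laurent polynomials in three variables with cleared
    denominators; [jacobi_identity] is the resulting identity, valid in any commutative ring, and
    [trimonB_reg] cancels the denominators again. Simplicity ([br1_simple]) comes from contracting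
    the first tensor factor with a functional that vanishes on the ideal ([slice_ideal]). Such
    functionals exist by [separating_functional]. With them [ideal_has_tmon] shortens the support of
    an element until a monomial lies in the ideal, and [ideal_tmonS] and [ideal_tmonP] reach the
    neighbouring degrees. *)

(** * Functionals separating a vector from a subspace *)

Section Separation.
Variables (k : fieldType) (M : lmodType k).
Implicit Types A : set M.

Lemma subspaceZ A (c : k) u : subspace A -> A u -> A (c *: u).
Proof. by move=> [A0 AD] Au; rewrite -[_ *: _]addr0; apply: AD. Qed.

Lemma subspaceD A u v : subspace A -> A u -> A v -> A (u + v).
Proof. by move=> [A0 AD] Au Av; rewrite -[u]scale1r; apply: AD. Qed.

Lemma subspaceB A u v : subspace A -> A u -> A v -> A (u - v).
Proof.
by move=> sA Au Av; apply: subspaceD => //; rewrite -scaleN1r; apply: subspaceZ.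
Qed.

Lemma subspaceZV A (c : k) u : subspace A -> c != 0 -> A (c *: u) -> A u.
Proof.
by move=> sA c0 /(subspaceZ c^-1 sA); rewrite scalerA mulVf // scale1r.
Qed.

(** By Zorn's lemma some subspace H is maximal among those containing A and avoiding v. If u is
    outside H, then H + k u contains v by maximality, so u lies in H + k v. *)
Lemma maximal_avoiding_subspace A v : subspace A -> ~ A v ->
  exists H, [/\ subspace H, A `<=` H, ~ H v &
    forall u, H u \/ exists c : k, H (u - c *: v)].
Proof.
move=> sA Av.
pose P : set (set M) := [set B | B = set0 \/ [/\ subspace B, A `<=` B & ~ B v]].
have [F FP Ftot|H [PH maxH]] := @Zorn_bigcup M P.
  have [[B0 FB0 [x B0x]]|noB] := pselect (exists2 B, F B & B !=set0); last first.
    left; apply/seteqP; split=> // x [B FB Bx].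
    by case: noB; exists B => //; exists x.
  have F_sub B y : F B -> B y -> [/\ subspace B, A `<=` B & ~ B v].
    by move=> FB By; have [B_0|//] := FP B FB; rewrite B_0 in By.
  have [sB0 AB0 _] := F_sub _ _ FB0 B0x.
  right; split; last by move=> [B FB Bv]; have [] := F_sub _ _ FB Bv.
  - split=> [|c u w [B FB Bu] [C FC Cw]]; first by exists B0 => //; apply: sB0.1.
    have [BC|CB] := Ftot _ _ FB FC.
    + exists C => //; have [sC _ _] := F_sub _ _ FC Cw.
      by apply: sC.2 => //; apply: BC.
    + exists B => //; have [sB _ _] := F_sub _ _ FB Bu.
      by apply: sB.2 => //; apply: CB.
  - by move=> y /AB0 B0y; exists B0.
have [H0|[sH AH Hv]] := PH.
  exfalso; apply: (maxH A); last by right; split.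
  rewrite H0; split=> [x []|].
  by move=> /(_ _ sA.1).
exists H; split=> // u; have [|Hu] := pselect (H u); first by left.
right.
pose B : set M := [set w | exists c : k, H (w - c *: u)].
have sB : subspace B.
  split; first by exists 0; rewrite scale0r subr0; apply: sH.1.
  move=> c w1 w2 [c1 H1] [c2 H2]; exists (c * c1 + c2).
  rewrite scalerDl -scalerA opprD addrACA -scalerBr; exact: sH.2.
have HB : H `<=` B by move=> w Hw; exists 0; rewrite scale0r subr0.
have [c Bc] : B v.
  apply: contrapT => Bv; apply: (maxH B); last first.
    by right; split=> // w /AH /HB.
  split=> // /(_ u) BH; apply/Hu/BH.
  by exists 1; rewrite scale1r subrr; apply: sH.1.
have c0 : c != 0.
  by apply/eqP => c0; apply: Hv; move: Bc; rewrite c0 scale0r subr0.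
exists c^-1; apply: (@subspaceZV _ (- c)) => //; first by rewrite oppr_eq0.
by rewrite scaleNr scalerBr scalerA divff // scale1r opprB.
Qed.

(** The whole space is the direct sum of H and k v, and the functional is the coordinate along v. *)
Lemma separating_functional A v : subspace A -> ~ A v ->
  exists phi : {scalar M}, (forall u, A u -> phi u = 0) /\ phi v = 1.
Proof.
move=> sA /(maximal_avoiding_subspace sA)[H [sH AH Hv cover]].
pose coord u : k := xget 0 [set c : k | H (u - c *: v)].
have uniqH u (c d : k) : H (u - c *: v) -> H (u - d *: v) -> c = d.
  move=> Hc Hd; apply: contrapT => /eqP; rewrite -subr_eq0 => cd.
  apply/Hv/(subspaceZV sH cd); have := subspaceB sH Hd Hc.
  by rewrite opprB addrC addrA subrK scalerBl.
have coordP u : H (u - coord u *: v).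
  rewrite /coord; case: xgetP => [//|] none.
  by have [Hu|[c /none]//] := cover u; rewrite scale0r subr0.
have coordE u (c : k) : H (u - c *: v) -> coord u = c.
  by move=> Hc; apply: uniqH (coordP u) Hc.
have linC : scalar coord.
  move=> c u w; apply: coordE.
  rewrite scalerDl -scalerA opprD addrACA -scalerBr.
  exact: sH.2.
pose C := GRing.isLinear.Build k M k *%R coord linC.
pose phi : {scalar M} := HB.pack coord C.
exists phi; split=> [u Au|]; apply: coordE.
  by rewrite scale0r subr0; apply: AH.
by rewrite scale1r subrr; apply: sH.1.
Qed.

End Separation.

(** * Maps of group algebras and cancellation of binomials *)

Section GroupAlgebraMaps.
Variable k : fieldType.

(** For additive [h] this is an algebra morphism; the substitutions of variables below are all of
    this kind. *)
Definition gmap (G H : zmodType) (h : G -> H) (f : grpalg k G) : grpalg k H :=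
  linext (fun g => gmon (h g)) f.

Fact gmap_linear (G H : zmodType) (h : G -> H) : linear (gmap h).
Proof. by move=> c u v; rewrite /gmap linearP. Qed.

HB.instance Definition _ (G H : zmodType) (h : G -> H) :=
  GRing.isLinear.Build k (grpalg k G) (grpalg k H) *:%R (gmap h) (gmap_linear h).

Lemma gmapU (G H : zmodType) (h : G -> H) g : gmap h (gmon g) = gmon (h g).
Proof. exact: linext_gmon. Qed.

Lemma gmapM (G H : zmodType) (h : G -> H) : {morph h : a b / a + b} ->
  {morph gmap h : p q / p * q}.
Proof.
move=> hD p q; move: p.
apply: (@eq_grpalg_lin _ _ _ (fun p => gmap h (p * q))
                             (fun p => gmap h p * gmap h q)) => [c u v|c u v|a].
- by rewrite mulrDl -scalerAl linearP.
- by rewrite linearP mulrDl -scalerAl.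
move: q; apply: (@eq_grpalg_lin _ _ _ (fun q => gmap h (gmon a * q))
                   (fun q => gmap h (gmon a) * gmap h q)) => [c u v|c u v|b].
- by rewrite mulrDr -scalerAr linearP.
- by rewrite linearP mulrDr -scalerAr.
by rewrite gmonM !gmapU gmonM hD.
Qed.

Lemma gmap_comp (G H K : zmodType) (h : G -> H) (h' : H -> K) f :
  gmap h' (gmap h f) = gmap (h' \o h) f.
Proof.
move: f; apply: (@eq_grpalg_lin _ _ _ (fun f => gmap h' (gmap h f)))
  => [c u v|c u v|a]; rewrite ?linearP //.
by rewrite !gmapU.
Qed.

(* The support of an element killed by [gmon u - gmon v] is stable under     *)
(* translation by [u - v], hence is empty because it is finite.              *)
Lemma gmonB_reg (G : zmodType) (u v : G) (p : grpalg k G) :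
  (forall n, (u - v) *+ n.+1 != 0) -> p * (gmon u - gmon v) = 0 -> p = 0.
Proof.
set d := u - v => d_tf p0.
have pS a : p@_a = p@_(a + d).
  have := congr1 (fun r : grpalg k G => r@_(a + u)) p0.
  rewrite mulrBr mcoeffB mcoeff0 !mcoeff_mulgmon addrK => /eqP.
  by rewrite subr_eq0 -addrA => /eqP.
have pSn n a : p@_a = p@_(a + d *+ n).
  elim: n => [|n IHn]; first by rewrite addr0.
  by rewrite IHn [LHS]pS -addrA -mulrSr.
apply/malgP=> a; rewrite mcoeff0; apply/eqP/negP => /negP nz_a.
pose s := [seq a + d *+ n | n <- iota 0 (size (msupp p)).+1].
have us : uniq s.
  rewrite map_inj_uniq ?iota_uniq // => m n /addrI.
  wlog mn : m n / (m <= n)%N => [wlo|mn_eq].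
    by have [/wlo//|/ltnW/wlo wlo' /esym/wlo' ->] := leqP m n.
  apply/eqP; rewrite eqn_leq mn leqNgt; apply/negP => lt_mn.
  have := d_tf (n - m).-1; rewrite prednK ?subn_gt0 // mulrnBr //.
  by rewrite mn_eq subrr eqxx.
have /(uniq_leq_size us) : {subset s <= msupp p}.
  by move=> _ /mapP[n _ ->]; rewrite -mcoeff_neq0 -pSn.
by rewrite size_map size_iota ltnn.
Qed.

End GroupAlgebraMaps.

(** * The quotient, bilinearity and skew-symmetry of the bracket *)

Section Bracket.
Variable k : fieldType.
Local Notation V := (laurent k).

Definition divdiff (f g : V) : laurent2 k := lquot (numer f g) (ly k - lx k).

Lemma divdiffP f g : divdiff f g * (ly k - lx k) = numer f g.
Proof. by have [q qE] := lyx_dvd f g; rewrite /divdiff (lquotP qE). Qed.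

Lemma br1E f g : br1 f g = toTensor (ly k * divdiff f g).
Proof. by []. Qed.

Lemma divdiff_bilinear : bilinear_for *:%R *:%R divdiff.
Proof.
have [nl nr] := numer_bilinear k.
by split=> u c v w; apply: lyx_reg; rewrite mulrDl -scalerAl !divdiffP ?nl ?nr.
Qed.

(** The equation characterizing the quotient is carried along an algebra morphism. With [h] placing
    x and y among three variables, this clears the denominator of a bracket. *)
Lemma gmap_divdiff (H : zmodType) (h : int * int -> H) a b :
  {morph h : u v / u + v} ->
  gmap h (ly k * divdiff a b) * (gmap h (ly k) - gmap h (lx k))
  = gmap h (ly k) *
    (gmap h (atx a) * gmap h (aty b) - gmap h (atx b) * gmap h (aty a)).
Proof.
move=> hD; have hB u v : gmap h u - gmap h v = gmap h (u - v :> laurent2 k).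
  by rewrite linearB.
by rewrite hB -(gmapM hD) -mulrA divdiffP (gmapM hD) /numer -hB !(gmapM hD).
Qed.

Lemma br1_bilinear : bilinear_for *:%R *:%R (@br1 k).
Proof.
have [dl dr] := divdiff_bilinear.
by split=> u c v w; rewrite !br1E ?dl ?dr mulrDr -scalerAr linearP.
Qed.

Definition lswap : laurent2 k -> laurent2 k :=
  gmap (fun ab : int * int => ((ab.2, ab.1) : int * int)).

Lemma lswapM : {morph lswap : p q / p * q}.
Proof. exact: gmapM. Qed.

Lemma tflip_toTensor p : tflip (toTensor p) = toTensor (lswap p).
Proof.
move: p; apply: (@eq_grpalg_lin _ _ _ (fun p => tflip (toTensor p))
                  (fun p => toTensor (lswap p))) => [c u v|c u v|[a b]].
- by rewrite toTensor_is_linear; apply: tflip_linear.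
- by rewrite /lswap gmap_linear toTensor_is_linear.
by rewrite /lswap gmapU -!xymonE !toTensorU tflipE.
Qed.

Lemma lswap_atx f : lswap (atx f) = aty f.
Proof. exact: gmap_comp. Qed.

Lemma lswap_aty f : lswap (aty f) = atx f.
Proof. exact: gmap_comp. Qed.

(** Numerator and denominator both change sign when x and y are exchanged. *)
Lemma lswap_divdiff f g : lswap (divdiff f g) = divdiff f g.
Proof.
have lB u v : lswap (u - v) = lswap u - lswap v by apply: linearB.
have sx : lswap (lx k) = ly k by exact: gmapU.
have sy : lswap (ly k) = lx k by exact: gmapU.
have -> : lswap (divdiff f g) = - lswap (- divdiff f g) by rewrite -raddfN opprK.
apply: lyx_reg; rewrite divdiffP mulNr -mulrN opprB.
have -> : lx k - ly k = lswap (ly k - lx k) by rewrite lB sx sy.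
rewrite -lswapM mulNr divdiffP /numer opprB lB !lswapM !lswap_atx !lswap_aty.
by move: (atx f) (atx g) (aty f) (aty g) => p q r s; ring.
Qed.

Lemma divdiffC f g : divdiff g f = - divdiff f g.
Proof. by apply: lyx_reg; rewrite mulNr !divdiffP opprB. Qed.

Lemma br1_skew (a b : V) :
  br1 a b + tflip (br1 b a) = 1 *: (a ⊗ b - b ⊗ a).
Proof.
have sy : lswap (ly k) = lx k by exact: gmapU.
rewrite !br1E tflip_toTensor lswapM sy lswap_divdiff (divdiffC a b) scale1r.
rewrite -!toTensorM -linearD -linearB /=; congr toTensor.
rewrite -/(numer a b) -divdiffP.
by ring.
Qed.

End Bracket.

(** * The Jacobi identity, through Laurent polynomials in three variables *)

Section Jacobi.
Variable k : fieldType.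
Local Notation V := (laurent k).
Local Notation laurent3 := (grpalg k (int * int * int)%type).
Local Notation tri a b c := (((a, b), c) : int * int * int).

Definition at1 : V -> laurent3 := gmap (fun a : int => tri a 0 0).
Definition at2 : V -> laurent3 := gmap (fun a : int => tri 0 a 0).
Definition at3 : V -> laurent3 := gmap (fun a : int => tri 0 0 a).

Definition at12 : laurent2 k -> laurent3 := gmap (fun p : int * int => tri p.1 p.2 0).
Definition at13 : laurent2 k -> laurent3 := gmap (fun p : int * int => tri p.1 0 p.2).
Definition at23 : laurent2 k -> laurent3 := gmap (fun p : int * int => tri 0 p.1 p.2).
(** The order is reversed, p(x3, x2): in [ractL] the second factor of p ends up in place 2, while
    the first one is bracketed and spread over places 1 and 3. *)
Definition at32 : laurent2 k -> laurent3 := gmap (fun p : int * int => tri 0 p.2 p.1).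

Let x1 : laurent3 := gmon (tri 1 0 0).
Let x2 : laurent3 := gmon (tri 0 1 0).
Let x3 : laurent3 := gmon (tri 0 0 1).

Definition toTensor3 : laurent3 -> (V ⊗ V ⊗ V)%type :=
  linext (fun abc => tmon k abc.1.1 ⊗ tmon k abc.1.2 ⊗ tmon k abc.2).

Fact toTensor3_linear : linear toTensor3.
Proof. by move=> c u v; rewrite /toTensor3 linearP. Qed.

HB.instance Definition _ :=
  GRing.isLinear.Build k laurent3 (V ⊗ V ⊗ V)%type *:%R toTensor3
    toTensor3_linear.

Lemma toTensor3U a b c :
  toTensor3 (gmon (tri a b c)) = tmon k a ⊗ tmon k b ⊗ tmon k c.
Proof. exact: linext_gmon. Qed.

Lemma trimonM a b c a' b' c' :
  gmon (tri a b c) * gmon (tri a' b' c') = gmon (tri (a + a') (b + b') (c + c'))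
  :> laurent3.
Proof. exact: gmonM. Qed.

Lemma eq_laurent2_bilin (M : lmodType k) (F H : laurent2 k -> V -> M) :
  bilinear_for *:%R *:%R F -> bilinear_for *:%R *:%R H ->
  (forall a b c, F (xymon k a b) (tmon k c) = H (xymon k a b) (tmon k c)) ->
  forall p v, F p v = H p v.
Proof.
move=> [Fl Fr] [Hl Hr] FH p v; move: p.
apply: (@eq_grpalg_lin _ _ _ (F ^~ v) (H ^~ v)) => [||[a b]]; first exact: Fl.
  exact: Hl.
move: v; apply: (@eq_grpalg_lin _ _ _ (F (gmon (a, b))) (H (gmon (a, b))));
  [exact: Fr|exact: Hr|exact: FH].
Qed.

Lemma bilinear_toTensorl (M : lmodType k) (F : (V ⊗ V ⊗ V)%type -> M) :
  linear F -> bilinear_for *:%R *:%R (fun p v => F (toTensor p ⊗ v)).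
Proof.
move=> linF; split=> u c x y; last by rewrite tensDr; apply: linF.
by rewrite toTensor_is_linear tensDl; apply: linF.
Qed.

Lemma bilinear_toTensorr (M : lmodType k) (F : (V ⊗ (V ⊗ V))%type -> M) :
  linear F -> bilinear_for *:%R *:%R (fun p v => F (v ⊗ toTensor p)).
Proof.
move=> linF; split=> u c x y; last by rewrite tensDl; apply: linF.
by rewrite toTensor_is_linear tensDr; apply: linF.
Qed.

Lemma toTensor3_12 p v : toTensor3 (at12 p * at3 v) = toTensor p ⊗ v.
Proof.
move: p v; apply: eq_laurent2_bilin => [||a b c].
- split=> ? c ? ?; first by rewrite /at12 linearP mulrDl -scalerAl linearP.
  by rewrite /at3 linearP mulrDr -scalerAr linearP.
- exact: (@bilinear_toTensorl _ id).
by rewrite toTensorU [at12 _]gmapU [at3 _]gmapU trimonM -toTensor3U /= add0r !addr0.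
Qed.

Lemma toTensor3_23 p v : toTensor3 (at1 v * at23 p) = tassoc (v ⊗ toTensor p).
Proof.
move: p v; apply: eq_laurent2_bilin => [||a b c].
- split=> ? c ? ?; first by rewrite /at23 linearP mulrDr -scalerAr linearP.
  by rewrite /at1 linearP mulrDl -scalerAl linearP.
- exact/bilinear_toTensorr/tassoc_linear.
rewrite toTensorU [at23 _]gmapU [at1 _]gmapU trimonM tassocE -toTensor3U /=.
by rewrite !add0r !addr0.
Qed.

Lemma toTensor3_13 p v : toTensor3 (at13 p * at2 v) = perm23 (toTensor p ⊗ v).
Proof.
move: p v; apply: eq_laurent2_bilin => [||a b c].
- split=> ? c ? ?; first by rewrite /at13 linearP mulrDl -scalerAl linearP.
  by rewrite /at2 linearP mulrDr -scalerAr linearP.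
- exact/bilinear_toTensorl/perm23_linear.
rewrite toTensorU [at13 _]gmapU [at2 _]gmapU trimonM perm23E -toTensor3U /=.
by rewrite !add0r !addr0.
Qed.

(** Permuting by (12) from v in front of p, or by (23) from v behind p, both leave v between the two
    factors of p. *)
Lemma toTensor3_perm12 p v :
  toTensor3 (at13 p * at2 v) = perm12 (tassoc (v ⊗ toTensor p)).
Proof.
rewrite toTensor3_13.
move: p v; apply: eq_laurent2_bilin => [||a b c].
- exact/bilinear_toTensorl/perm23_linear.
- apply: (@bilinear_toTensorr _ (@perm12 k V \o @tassoc k V V V)) => c u v.
  by rewrite /comp (tassoc_linear c u v); apply: perm12_linear.
by rewrite toTensorU tassocE perm12E perm23E.
Qed.

Lemma at12_br a b :
  at12 (ly k * divdiff a b) * (x2 - x1) = x2 * (at1 a * at2 b - at1 b * at2 a).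
Proof.
have xE : at12 (lx k) = x1 by exact: gmapU.
have yE : at12 (ly k) = x2 by exact: gmapU.
by rewrite -yE -xE gmap_divdiff // !gmap_comp.
Qed.

Lemma at13_br a b :
  at13 (ly k * divdiff a b) * (x3 - x1) = x3 * (at1 a * at3 b - at1 b * at3 a).
Proof.
have xE : at13 (lx k) = x1 by exact: gmapU.
have yE : at13 (ly k) = x3 by exact: gmapU.
by rewrite -yE -xE gmap_divdiff // !gmap_comp.
Qed.

Lemma at23_br a b :
  at23 (ly k * divdiff a b) * (x3 - x2) = x3 * (at2 a * at3 b - at2 b * at3 a).
Proof.
have xE : at23 (lx k) = x2 by exact: gmapU.
have yE : at23 (ly k) = x3 by exact: gmapU.
by rewrite -yE -xE gmap_divdiff // !gmap_comp.
Qed.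

Lemma at32_br a b :
  at32 (ly k * divdiff a b) * (x2 - x3) = x2 * (at3 a * at2 b - at3 b * at2 a).
Proof.
have xE : at32 (lx k) = x3 by exact: gmapU.
have yE : at32 (ly k) = x2 by exact: gmapU.
by rewrite -yE -xE gmap_divdiff // !gmap_comp.
Qed.

(** Having a preimage P with prescribed product P d is stable under linear combinations, so it
    suffices to exhibit P on monomials. *)
Lemma lin_preimage (F : laurent2 k -> (V ⊗ V ⊗ V)%type) (d : laurent3)
    (N : laurent2 k -> laurent3) :
  linear F -> linear N ->
  (forall i j, exists2 P, F (xymon k i j) = toTensor3 P & P * d = N (xymon k i j)) ->
  forall p, exists2 P, F p = toTensor3 P & P * d = N p.
Proof.
move=> linF linN FN; apply: grpalg_subspace => [|[i j]]; last exact: FN.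
pose F' : {linear _ -> _} := HB.pack F (GRing.isLinear.Build _ _ _ _ F linF).
pose N' : {linear _ -> _} := HB.pack N (GRing.isLinear.Build _ _ _ _ N linN).
split=> [|c u v [P FP NP] [Q FQ NQ]].
  exists 0; first by rewrite (linear0 toTensor3); apply: (linear0 F').
  by rewrite mul0r; apply/esym/(linear0 N').
exists (c *: P + Q); first by rewrite linF FP FQ linearP.
by rewrite linN mulrDl -scalerAl NP NQ.
Qed.

Lemma gmap_comb_linear (G H : zmodType) (h h' : G -> H) (u v w : grpalg k H) :
  linear (fun p : grpalg k G => w * (gmap h p * u - gmap h' p * v)).
Proof.
move=> c p q; rewrite !gmap_linear !mulrDl -!scalerAl opprD addrACA -scalerBr.
by rewrite mulrDr -scalerAr.
Qed.

Lemma gmon3E i j l :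
  gmon (tri i j l) = at1 (tmon k i) * at2 (tmon k j) * at3 (tmon k l) :> laurent3.
Proof.
by rewrite [at1 _]gmapU [at2 _]gmapU [at3 _]gmapU !trimonM !add0r !addr0.
Qed.

Lemma at1_1 : at1 (tmon k 0) = 1. Proof. exact: gmapU. Qed.
Lemma at2_1 : at2 (tmon k 0) = 1. Proof. exact: gmapU. Qed.
Lemma at3_1 : at3 (tmon k 0) = 1. Proof. exact: gmapU. Qed.

Lemma at12U i j : at12 (xymon k i j) = at1 (tmon k i) * at2 (tmon k j).
Proof. by rewrite [LHS]gmapU gmon3E at3_1 mulr1. Qed.

Lemma at13U i j : at13 (xymon k i j) = at1 (tmon k i) * at3 (tmon k j).
Proof. by rewrite [LHS]gmapU gmon3E at2_1 mulr1. Qed.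

Lemma at23U i j : at23 (xymon k i j) = at2 (tmon k i) * at3 (tmon k j).
Proof. by rewrite [LHS]gmapU gmon3E at1_1 mul1r. Qed.

Lemma at32U i j : at32 (xymon k i j) = at3 (tmon k i) * at2 (tmon k j).
Proof. by rewrite [LHS]gmapU gmon3E at1_1 mul1r mulrC. Qed.

(** For p = u(x) v(y) the action is the bracket of a and u in x1, x2 times v(x3). Its numerator
    regroups into values of p, which makes sense for every p; the next two lemmas follow the same
    pattern. *)
Lemma actL_preimage a p : exists2 P, actL (@br1 k) a (toTensor p) = toTensor3 P &
  P * (x2 - x1) = x2 * (at23 p * at1 a - at13 p * at2 a).
Proof.
move: p; apply: lin_preimage => [c u v||i j]; last 1 first.
- rewrite toTensorU (actLE (br1_bilinear k)) br1E -toTensor3_12.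
  eexists; first by [].
  rewrite mulrAC at12_br at23U at13U.
  move: (at1 _) (at2 _) (at3 _) (at1 _) (at2 _) x2 => *; ring.
- rewrite toTensor_is_linear.
  exact: (tlift_linear (actL_bilinear (br1_bilinear k) a)).
- exact: gmap_comb_linear.
Qed.

Lemma actR_preimage b p : exists2 P, actR (@br1 k) b (toTensor p) = toTensor3 P &
  P * (x3 - x2) = x3 * (at13 p * at2 b - at12 p * at3 b).
Proof.
move: p; apply: lin_preimage => [c u v||i j]; last 1 first.
- rewrite toTensorU (actRE (br1_bilinear k)) br1E -toTensor3_23.
  eexists; first by [].
  rewrite -mulrA at23_br at13U at12U.
  move: (at1 _) (at2 _) (at3 _) (at2 _) (at3 _) x3 => *; ring.
- rewrite toTensor_is_linear.
  exact: (tlift_linear (actR_bilinear (br1_bilinear k) b)).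
- exact: gmap_comb_linear.
Qed.

Lemma ractL_preimage p c : exists2 P, ractL (@br1 k) (toTensor p) c = toTensor3 P &
  P * (x3 - x1) = x3 * (at12 p * at3 c - at32 p * at1 c).
Proof.
move: p; apply: lin_preimage => [d u v||i j]; last 1 first.
- rewrite toTensorU (ractLE (br1_bilinear k)) br1E -toTensor3_13.
  eexists; first by [].
  rewrite mulrAC at13_br at12U at32U.
  move: (at1 _) (at2 _) (at3 _) (at1 _) (at3 _) x3 => *; ring.
- rewrite toTensor_is_linear.
  exact: (tlift_linear (ractL_bilinear (br1_bilinear k) c)).
- exact: gmap_comb_linear.
Qed.

(** Here [bc23] stands for {{b,c}} in the variables x2, x3, and so on; the summand [ac13 * b2] is
    the weight term. *)
Lemma jacobi_identity (R : comNzRingType)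
    (x y z a1 a2 a3 b1 b2 b3 c1 c2 c3 P1 P2 P3 : R)
    (bc23 bc13 ac13 ac12 ab12 ab32 : R) :
  P1 * (y - x) = y * (bc23 * a1 - bc13 * a2) ->
  P2 * (z - y) = z * (ac13 * b2 - ac12 * b3) ->
  P3 * (z - x) = z * (ab12 * c3 - ab32 * c1) ->
  bc23 * (z - y) = z * (b2 * c3 - c2 * b3) ->
  bc13 * (z - x) = z * (b1 * c3 - c1 * b3) ->
  ac13 * (z - x) = z * (a1 * c3 - c1 * a3) ->
  ac12 * (y - x) = y * (a1 * c2 - c1 * a2) ->
  ab12 * (y - x) = y * (a1 * b2 - b1 * a2) ->
  ab32 * (y - z) = y * (a3 * b2 - b3 * a2) ->
  (P1 - P2 - P3 + ac13 * b2) * (y - x) * (z - y) * (z - x) = 0.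
Proof.
move=> hP1 hP2 hP3 h1 h2 h3 h4 h5 h6.
transitivity ((P1 * (y - x)) * (z - y) * (z - x) - (P2 * (z - y)) * (y - x) * (z - x)
  - (P3 * (z - x)) * (y - x) * (z - y) + (ac13 * (z - x)) * b2 * (y - x) * (z - y)).
  by ring.
rewrite hP1 hP2 hP3.
(* Each bracket is paired with its own denominator. The sign of the [ab32] term turns because that
   denominator is y - z. *)
transitivity (y * ((bc23 * (z - y)) * (z - x) * a1 - (bc13 * (z - x)) * (z - y) * a2)
  - z * ((ac13 * (z - x)) * (y - x) * b2 - (ac12 * (y - x)) * (z - x) * b3)
  - z * ((ab12 * (y - x)) * (z - y) * c3 + (ab32 * (y - z)) * (y - x) * c1)
  + (ac13 * (z - x)) * b2 * (y - x) * (z - y)).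
  by ring.
by rewrite h1 h2 h3 h4 h5 h6; ring.
Qed.

Lemma tri_torsion_free (u : int * int * int) n : u != 0 -> u *+ n.+1 != 0.
Proof.
apply: contra => /eqP un; apply/eqP.
have mulE m : u *+ m = tri (u.1.1 *+ m) (u.1.2 *+ m) (u.2 *+ m).
  by elim: m => // m IHm; rewrite mulrS IHm !mulrS.
move: un; rewrite mulE => -[/eqP + /eqP + /eqP].
rewrite !mulrn_eq0 /= => /eqP + /eqP + /eqP.
by case: u {mulE} => [[i j] l] /= -> -> ->.
Qed.

Lemma trimonB_reg (u v : int * int * int) (p : laurent3) :
  u != v -> p * (gmon u - gmon v) = 0 -> p = 0.
Proof.
move=> uv; apply: gmonB_reg => n; apply: tri_torsion_free.
by rewrite subr_eq0.
Qed.

Lemma br1_jacobi (a b c : V) :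
  actL (@br1 k) a (br1 b c) - actR (@br1 k) b (br1 a c)
    - ractL (@br1 k) (br1 a b) c
  = - (1 *: perm12 (tassoc (b ⊗ br1 a c))).
Proof.
rewrite !br1E -toTensor3_perm12 scale1r.
have [P1 -> hP1] := actL_preimage a (ly k * divdiff b c).
have [P2 -> hP2] := actR_preimage b (ly k * divdiff a c).
have [P3 -> hP3] := ractL_preimage (ly k * divdiff a b) c.
have := jacobi_identity hP1 hP2 hP3 (at23_br b c) (at13_br b c) (at13_br a c)
  (at12_br a c) (at12_br a b) (at32_br a b).
set Q := at13 _ * _ => X0.
(* The factors x3 - x1, x3 - x2 and x2 - x1 are cancelled from the right. *)
have X1 := @trimonB_reg (tri 0 0 1) (tri 1 0 0) _ isT X0.
have X2 := @trimonB_reg (tri 0 0 1) (tri 0 1 0) _ isT X1.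
have X3 := @trimonB_reg (tri 0 1 0) (tri 1 0 0) _ isT X2.
apply/eqP; rewrite -addr_eq0 -!linearB -linearD; apply/eqP.
by rewrite X3 linear0.
Qed.

End Jacobi.

(** * Ideals, contractions and simplicity *)

Section Simplicity.
Variable k : fieldType.
Local Notation V := (laurent k).
Implicit Types (phi : {scalar V}) (I : set V).

(** The quotient is x^m y^m times the geometric sum for (y^n - x^n)/(y - x). Because of the extra
    factor y, the second exponents run from m + 1 to m + n. *)
Lemma br1_tmon (m : int) (n : nat) :
  br1 (tmon k m) (tmon k (m + n%:Z))
  = \sum_(i < n) tmon k (m + i%:Z) ⊗ tmon k (m + n%:Z - i%:Z).
Proof.
set S := \sum_(i < n) ly k ^+ (n.-1 - i) * lx k ^+ i.
have SE : xymon k m m * S * (ly k - lx k) = numer (tmon k m) (tmon k (m + n%:Z)).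
  rewrite /numer !atxyU -mulrA [X in _ * X]mulrC -subrXX mulrBr !xymonX !xymonM.
  by rewrite !mul0rn !addr0 natz.
rewrite br1E /divdiff (lquotP SE) /S !mulr_sumr linear_sum.
apply: eq_bigr => -[i /= lt_in] _.
rewrite !xymonX !xymonM !mul0rn toTensorU; congr (tmon k _ ⊗ tmon k _); lia.
Qed.

(** The contraction phi ⊗ id. *)
Definition slice phi : (V ⊗ V)%type -> V := tlift (fun u v => phi u *: v).

Fact slice_bilinear phi :
  bilinear_for *:%R *:%R (fun u v : V => phi u *: v).
Proof.
have E (d c : k) (x y : V) : d *: (c *: x + y) = c *: (d *: x) + d *: y.
  by rewrite scalerDr !scalerA mulrC.
split=> u c x y; first by rewrite linearP scalerDl -scalerA.
exact: E.
Qed.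

Lemma slice_linear phi : linear (slice phi).
Proof. exact/tlift_linear/slice_bilinear. Qed.

HB.instance Definition _ phi :=
  GRing.isLinear.Build k (V ⊗ V)%type V *:%R (slice phi) (slice_linear phi).

Lemma sliceE phi u v : slice phi (u ⊗ v) = phi u *: v.
Proof. exact/tliftE/slice_bilinear. Qed.

Lemma slice_ideal phi I z : subspace I -> (forall u, I u -> phi u = 0) ->
  ssum (subtens I setT) (subtens setT I) z -> I (slice phi z).
Proof.
move=> sI phiI.
have sS : subspace [set z | I (slice phi z)].
  split=> [|c u v /= Iu Iv]; first by rewrite /mkset linear0; apply: sI.1.
  by rewrite linearP; apply: sI.2.
move=> [u + [v + <-]].
move=> /(span_min sS) Iu /(span_min sS) Iv; rewrite linearD.
apply: subspaceD => //.
  apply: Iu => _ [a Ia [b _ <-]].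
  by rewrite /mkset sliceE phiI // scale0r; apply: sI.1.
by apply: Iv => _ [a _ [b Ib <-]]; rewrite /mkset sliceE; apply: subspaceZ.
Qed.

Lemma slice_br1l phi I f g : dL_ideal (@br1 k) I -> (forall u, I u -> phi u = 0) ->
  I g -> I (slice phi (br1 f g)).
Proof.
move=> [sI idI] phiI Ig; apply: slice_ideal => //; apply: idI.
exists (br1 f g); first by apply: Defs.sub_span; exists f => //; exists g.
by exists 0; rewrite ?addr0 //; apply: (span_subspace _).1.
Qed.

Lemma slice_br1r phi I f g : dL_ideal (@br1 k) I -> (forall u, I u -> phi u = 0) ->
  I g -> I (slice phi (br1 g f)).
Proof.
move=> [sI idI] phiI Ig; apply: slice_ideal => //; apply: idI.
exists 0; first exact: (span_subspace _).1.
by exists (br1 g f); rewrite ?add0r //; apply: Defs.sub_span; exists g => //; exists f.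
Qed.

Lemma mcoeff_slice_br1 phi (m j : int) (n : nat) :
  (slice phi (br1 (tmon k m) (tmon k (m + n%:Z))))@_j
  = \sum_(i < n) phi (tmon k (m + i%:Z)) * (m + n%:Z - i%:Z == j)%:R :> k.
Proof.
rewrite br1_tmon linear_sum raddf_sum; apply: eq_bigr => i _.
by rewrite /= sliceE mcoeffZ tmonE mcoeff_gmon.
Qed.

Definition supported_in (g : V) (a : int) (n : nat) :=
  forall j, g@_j != 0 -> a <= j <= a + n%:Z.

Lemma mcoeff_slice_br1_sum phi a n g j : supported_in g a n ->
  (slice phi (br1 (tmon k a) g))@_j
  = \sum_(b < n.+1) g@_(a + b%:Z) *
      \sum_(i < b) phi (tmon k (a + i%:Z)) * (a + b%:Z - i%:Z == j)%:R :> k.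
Proof.
move=> gsup.
have gE : g = \sum_(b < n.+1) g@_(a + b%:Z) *: tmon k (a + b%:Z).
  apply/malgP => l; rewrite raddf_sum /=.
  have [/andP[al la]|nal] := boolP (a <= l <= a + n%:Z).
    have ln : (`|l - a| < n.+1)%N by lia.
    rewrite (bigD1 (Ordinal ln)) //= mcoeffZ tmonE mcoeff_gmon.
    have -> : a + `|l - a|%N%:Z = l by lia.
    rewrite eqxx mulr1 big1 ?addr0 // => i /eqP il.
    rewrite mcoeffZ tmonE mcoeff_gmon; case: eqP => [E|]; last by rewrite mulr0.
    by case: il; apply: val_inj => /=; lia.
  rewrite big1 => [|i _]; first by apply: contraNeq nal => /gsup.
  rewrite mcoeffZ tmonE mcoeff_gmon; case: eqP => [E|]; last by rewrite mulr0.
  by case/negP: nal; have := ltn_ord i; lia.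
have [_ brr] := br1_bilinear k.
pose F := GRing.isLinear.Build k V (V ⊗ V)%type *:%R (br1 (tmon k a)) (brr _).
pose B : {linear V -> (V ⊗ V)%type} := HB.pack (br1 (tmon k a)) F.
rewrite {1}gE -[br1 _ _]/(B _) !linear_sum raddf_sum; apply: eq_bigr => b _.
by rewrite !linearZ /= mcoeffZ mcoeff_slice_br1.
Qed.

(** The second exponents a + b - i have i < b, so they never reach down to a: the interval loses its
    left end. *)
Lemma slice_supported phi g a n : supported_in g a n.+1 ->
  supported_in (slice phi (br1 (tmon k a) g)) (a + 1) n.
Proof.
move=> gsup j; rewrite (mcoeff_slice_br1_sum _ _ gsup).
apply: contraNT => nj; apply/eqP/big1 => b _; rewrite big1 ?mulr0 // => i _.
case: eqP => [E|]; last by rewrite mulr0.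
by case/negP: nj; have := ltn_ord i; have := ltn_ord b; lia.
Qed.

(** The top degree arises only from the top term of g, and there only from i = 0, whose first factor
    is t^a. *)
Lemma slice_top phi g a n : supported_in g a n.+1 ->
  (slice phi (br1 (tmon k a) g))@_(a + n.+1%:Z)
  = g@_(a + n.+1%:Z) * phi (tmon k a).
Proof.
move=> gsup; rewrite (mcoeff_slice_br1_sum _ _ gsup).
rewrite big_ord_recr /= big1 ?add0r => [|b _]; last first.
  rewrite big1 ?mulr0 // => i _; case: eqP => [E|]; last by rewrite mulr0.
  by have := ltn_ord b; lia.
congr (_ * _); rewrite big_ord_recl big1 ?addr0 => [|i _].
  by rewrite eqxx mulr1.
case: eqP => [E|]; last by rewrite mulr0.
by move: E; rewrite lift0; lia.
Qed.

(** Induction on the length of the support. A functional with value 1 at t^a keeps the top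
    coefficient, so the contraction is nonzero while its support is shorter. *)
Lemma ideal_has_tmon I g a n : dL_ideal (@br1 k) I -> I g -> g != 0 ->
  supported_in g a n -> exists m, I (tmon k m).
Proof.
move=> idI; have sI := idI.1.
elim: n g a => [|n IHn] g a Ig g0 gsup.
  have gE : g = g@_a *: tmon k a.
    apply/malgP => j; rewrite mcoeffZ tmonE mcoeff_gmon.
    case: eqP => [->|ja]; first by rewrite mulr1.
    by rewrite mulr0; apply: contra_notP ja => /eqP/gsup; lia.
  exists a; apply: (@subspaceZV _ _ _ g@_a) => //; last by rewrite -gE.
  by apply: contraNneq g0 => ga; rewrite gE ga scale0r.
have [top0|top] := eqVneq (g@_(a + n.+1%:Z)) 0.
  apply: (IHn g a) => // j gj; have := gsup j gj.
  have [E|] := eqVneq j (a + n.+1%:Z); last by lia.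
  by move: gj; rewrite E top0 eqxx.
have [Ia|Ia] := pselect (I (tmon k a)); first by exists a.
have [phi [phiI phia]] := separating_functional sI Ia.
apply: (IHn (slice phi (br1 (tmon k a) g)) (a + 1)).
- exact: slice_br1l.
- apply: contraNneq top => h0.
  by have := slice_top phi gsup; rewrite h0 mcoeff0 phia mulr1 => <-.
- exact: slice_supported.
Qed.

Lemma exists_supported_in (g : V) : exists a n, supported_in g a n.
Proof.
(* The sum of the absolute values bounds every exponent. *)
pose m := (\sum_(j <- msupp g) `|j|)%N.
exists (- m%:Z), (m + m)%N => j; rewrite mcoeff_neq0 => jg.
suff: (`|j| <= m)%N by lia.
by rewrite /m (big_rem j) //= leq_addr.
Qed.

Lemma slice_br1_tmon2 phi (m : int) :
  slice phi (br1 (tmon k m) (tmon k (m + 2)))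
  = phi (tmon k m) *: tmon k (m + 2) + phi (tmon k (m + 1)) *: tmon k (m + 1).
Proof.
rewrite (br1_tmon m 2) big_ord_recl big_ord1 linearD /= !sliceE.
have -> : m + 2%:Z - (lift ord0 (ord0 : 'I_1))%:Z = m + 1 by rewrite lift0 /=; lia.
by rewrite addr0 subr0.
Qed.

(** If t^(m+1) were outside I, a functional equal to 1 there and 0 on I would contract {{t^m,
    t^(m+2)}} to t^(m+1) itself. *)
Lemma ideal_tmonS I m : dL_ideal (@br1 k) I -> I (tmon k m) -> I (tmon k (m + 1)).
Proof.
move=> idI Im; apply: contrapT => nI; apply: (nI).
have [phi [phiI phi1]] := separating_functional idI.1 nI.
have := slice_br1r (tmon k (m + 2)) idI phiI Im.
by rewrite slice_br1_tmon2 phi1 phiI // scale0r add0r scale1r.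
Qed.

(** The same contraction now has the further term phi(t^m) t^(m+2), which lies in I and is
    subtracted. *)
Lemma ideal_tmonP I m : dL_ideal (@br1 k) I -> I (tmon k (m + 2)) ->
  I (tmon k (m + 1)).
Proof.
move=> idI Im; apply: contrapT => nI; apply: (nI).
have [phi [phiI phi1]] := separating_functional idI.1 nI.
have := slice_br1l (tmon k m) idI phiI Im.
rewrite slice_br1_tmon2 phi1 scale1r => Isum.
have := subspaceB idI.1 Isum (subspaceZ (phi (tmon k m)) idI.1 Im).
by rewrite addrAC subrr add0r.
Qed.

Lemma br1_simple : dL_simple (@br1 k).
Proof.
split.
  (* The witness is {{1, t}} = 1 ⊗ t. *)
  exists (tmon k 0), (tmon k (0 + 1%:Z)); rewrite br1_tmon big_ord1 -toTensorU.
  rewrite -(linear0 (@toTensor k)).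
  rewrite (inj_eq (bij_inj (toTensor_bij k))).
  apply/eqP => /malgP/(_ (0, 1)) /eqP.
  by rewrite xymonE mcoeff_gmon mcoeff0 oner_eq0.
move=> I idI; have sI := idI.1.
have [[g Ig g0]|I0] := pselect (exists2 g, I g & g != 0); last first.
  left; apply/seteqP; split=> [g Ig|_ ->]; last exact: sI.1.
  by have [->|g0] := eqVneq g 0; [|case: I0; exists g].
right; have [a [n gsup]] := exists_supported_in g.
have [m Im] := ideal_has_tmon idI Ig g0 gsup.
have up j : I (tmon k (m + j%:Z)).
  elim: j => [|j IHj]; first by rewrite addr0.
  have -> : m + j.+1%:Z = m + j%:Z + 1 by lia.
  exact: ideal_tmonS.
have down j : I (tmon k (m - j%:Z)).
  elim: j => [|j IHj]; first by rewrite subr0.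
  (* The new degree is the middle one between m - (j+2) and m - j, and the latter is already
     known. *)
  have -> : m - j.+1%:Z = m - j.+2%:Z + 1 by lia.
  apply: ideal_tmonP => //.
  by have -> : m - j.+2%:Z + 2 = m - j%:Z by lia.
apply/seteqP; split=> // f _; apply: grpalg_subspace f => // j; rewrite -tmonE.
have [le_mj|/ltW le_jm] := leP m j.
  have -> : j = m + `|j - m|%N%:Z by lia.
  exact: up.
have -> : j = m - `|m - j|%N%:Z by lia.
exact: down.
Qed.

End Simplicity.

Theorem theorem3p3 (k : fieldType) :
  is_double_Lie (@br1 k) 1 /\ dL_simple (@br1 k).
Proof.
split; last exact: br1_simple.
by split; [exact: br1_bilinear|exact: br1_skew|exact: br1_jacobi].
Qed.
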